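(* Every even Artin group whose defining graph is a triangle graph is poly-free.
   Context: Let $\Gamma$ be a finite simple graph with vertex set $V$ and edges labelled by integers $m_e\ge 2$. The Artin group is $A_\Gamma=\langle V \mid {}_{m_e}(uv)={}_{m_e}(vu) \text{ for } e=\{u,v\}\in E\rangle$, where ${}_{m}(uv)$ is the alternating product $uvu\cdots$ of length $m$. It is even if all labels are even. A triangle graph is the complete graph on three vertices (each of the three edges carrying an even label $\ge 2$). A group $G$ is poly-free if there is a chain $1=G_0\unlhd G_1\unlhd\cdots\unlhd G_N=G$ with each $G_{i+1}/G_i$ free. *)

(* Defs.v *)
From Stdlib Require List.
From mathcomp Require Import all_boot.
Set Implicit Arguments. Unset Strict Implicit. Unset Printing Implicit Defensive.

Section SetoidGroup.
Variables (T : Type) (eqv : T -> T -> Prop)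
          (mul : T -> T -> T) (inv : T -> T) (one : T).

Definition is_subgroup (H : T -> Prop) : Prop :=
  [/\ (forall x y, eqv x y -> H x -> H y), H one,
      (forall x y, H x -> H y -> H (mul x y)) & (forall x, H x -> H (inv x))].

(* H is a normal subgroup of K (both assumed subgroups of the ambient group) *)
Definition normal_in (H K : T -> Prop) : Prop :=
  (forall x, H x -> K x) /\
  (forall k h, K k -> H h -> H (mul (mul (inv k) h) k)).

Definition eval_word (l : seq (T * bool)) : T :=
  foldr (fun p acc => mul (if p.2 then inv p.1 else p.1) acc) one l.

(* a word over representatives of cosets of H is freely reduced in K/H:
   no letter is followed by the inverse of (the coset of) the same letter *)
Fixpoint reduced_mod (H : T -> Prop) (l : seq (T * bool)) : Prop :=
  match l with
  | p :: ((q :: _) as r) =>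
      ~ (q.2 = ~~ p.2 /\ H (mul (inv p.1) q.1)) /\ reduced_mod H r
  | _ => True
  end.

(* The quotient K/H (H normal in K) is a free group: there is a set S of
   elements of K whose cosets form a free basis of K/H, i.e. they generate
   K/H and every nonempty freely reduced word in them is nontrivial in K/H. *)
Definition free_quotient (K H : T -> Prop) : Prop :=
  exists S : T -> Prop,
    [/\ (forall s, S s -> K s),
        (forall k, K k -> exists l : seq (T * bool),
             (forall p, List.In p l -> S p.1) /\ H (mul (inv k) (eval_word l)))
      & (forall l : seq (T * bool), (forall p, List.In p l -> S p.1) ->
             l <> [::] -> reduced_mod H l -> ~ H (eval_word l))].

Definition poly_free : Prop :=
  exists (N : nat) (G : nat -> T -> Prop),
    [/\ (forall i, is_subgroup (G i)),
        (forall x, G 0 x <-> eqv x one),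
        (forall x, G N x)
      & (forall i, i < N -> normal_in (G i) (G i.+1) /\ free_quotient (G i.+1) (G i))].

End SetoidGroup.

Section Artin.
Variables (V : Type) (edge : V -> V -> Prop) (m : V -> V -> nat).

(* words in the generators: (v, false) = v, (v, true) = v^{-1} *)
Definition word := seq (V * bool).

Definition winv (w : word) : word := rev (map (fun p => (p.1, ~~ p.2)) w).

Definition alt (n : nat) (u v : V) : word :=
  mkseq (fun i => (if odd i then v else u, false)) n.

Inductive artin_eq : word -> word -> Prop :=
| ae_refl w : artin_eq w w
| ae_sym w1 w2 : artin_eq w1 w2 -> artin_eq w2 w1
| ae_trans w1 w2 w3 : artin_eq w1 w2 -> artin_eq w2 w3 -> artin_eq w1 w3
| ae_cancel (a b : word) (x : V) (e : bool) :
    artin_eq (a ++ (x, e) :: (x, ~~ e) :: b) (a ++ b)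
| ae_rel (a b : word) (u v : V) : edge u v ->
    artin_eq (a ++ alt (m u v) u v ++ b) (a ++ alt (m u v) v u ++ b).

Definition artin_poly_free : Prop :=
  poly_free artin_eq (@cat (V * bool)) winv [::].

End Artin.

Definition tri_label (m01 m02 m12 : nat) (u v : 'I_3) : nat :=
  match (val u + val v)%N with
  | 1 => m01 | 2 => m02 | 3 => m12 | _ => 0
  end.

Definition tri_edge (u v : 'I_3) : Prop := u != v.

(* Main.v *)
From HB Require Import structures.
From Stdlib Require Import Setoid Morphisms.
Require Import Defs.
From mathcomp Require Import all_boot.
From mathcomp Require Import ssralg ssrnum ssrint intdiv zify.

(* Name the vertices a, b, c so that the labels are 2(k+1) on ab, 2l on ac and
   2n on bc, with k >= 1 and n >= 2, or with l = n = 1. Killing c retracts the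
   group A onto D = <a, b>, and with x = ab and t_i = x^i a x^-i (i mod k+1) one
   has D = F(t_0, ..., t_k) >| <x>. So 1 < K < ker(A -> Z) < A, where K is the
   kernel of A -> D and a -> 0, b -> 1, c -> 0, has second and third quotients
   free, and it remains to see that K is free.

   K is generated by the conjugates c_d of c by d in D; the relations say that
   products of l consecutive terms along a line (d a^i), and of n consecutive
   terms along a line (d b^i), do not change when shifted by one step. Hence each
   line is determined by any l (resp. n) consecutive terms. D sits over the Cayley
   tree of F(t_0, ..., t_k), in which all these lines are geodesics. One chooses on
   every line a window of l (resp. n) free terms near the point closest to the root
   in such a way that no element of D is outside the windows of both of its lines;
   the equations can then be solved by well-founded recursion, and the elements
   lying in both windows form a basis of K. When l = n = 1 all c_d are equal.

   That the basis is free is checked by letting A act on D x F(D), with a and b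
   acting on D and c sending (d, y) to (d, y * f d), f being the solution. *)
Set Implicit Arguments. Unset Strict Implicit. Unset Printing Implicit Defensive.
Import GRing.Theory.

(** * Free groups *)

Section FreeGroup.
Variable X : choiceType.
Implicit Types (x y : X * bool) (s t : seq (X * bool)).

Definition linv x := (x.1, ~~ x.2).

Lemma linvK : involutive linv.
Proof. by case=> a b; rewrite /linv /= negbK. Qed.

Lemma linv_sym x y : (x == linv y) = (y == linv x).
Proof. by rewrite -(inj_eq (inv_inj linvK)) linvK eq_sym. Qed.

Definition freduced s := sorted (fun x y => y != linv x) s.

Definition push x s :=
  if s is y :: s' then if y == linv x then s' else x :: s else [:: x].

Lemma push_reduced x s : freduced s -> freduced (push x s).
Proof.
case: s => //= y s; case: eqP => [_|/eqP ne] /=; first exact: path_sorted.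
by rewrite /freduced /= ne.
Qed.

(** Reducedness enters when [push x s] cancels the head of [s]: the next letter is then not [x], so
    pushing [linv x] puts the removed letter back. *)
Lemma pushK x s : freduced s -> push (linv x) (push x s) = s.
Proof.
case: s => [|y s] /=; first by rewrite linvK eqxx.
case: eqP => [->|ne] /=; last by rewrite linvK eqxx.
by case: s => //= z s /andP[/negPf->].
Qed.

Lemma foldr_push_reduced s t : freduced s -> freduced (foldr push s t).
Proof. by move=> rs; elim: t => //= x t; apply: push_reduced. Qed.

Lemma foldr_push_push s t x : freduced s ->
  foldr push s (push x t) = push x (foldr push s t).
Proof.
move=> rs; case: t => //= y t; case: eqP => //= ->.
by rewrite -{1}[x]linvK pushK // foldr_push_reduced.
Qed.

(* A word is listed from its last letter to its first, so that right
   multiplication by a generator acts at the head of the list. *)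
Record free_group := FreeGroup { fg_word : seq (X * bool); _ : freduced fg_word }.
HB.instance Definition _ := [isSub for fg_word].
HB.instance Definition _ := [Choice of free_group by <:].
Implicit Types u v w : free_group.

Lemma fg_wordP u : freduced (fg_word u). Proof. by case: u. Qed.

Definition fg_one : free_group := @FreeGroup [::] isT.
Definition fg_mul u v :=
  FreeGroup (foldr_push_reduced (fg_word v) (fg_wordP u)).

Lemma fg_inv_subproof u : freduced (rev (map linv (fg_word u))).
Proof.
rewrite /freduced rev_sorted sorted_map; case: u => s /=; apply: sub_sorted => x y.
by apply: contra_neq => /= ->; rewrite !linvK.
Qed.
Definition fg_inv u := FreeGroup (fg_inv_subproof u).

Lemma fg_mulA : associative fg_mul.
Proof.
move=> u v w; apply: val_inj => /=; elim: (fg_word w) => //= x t <-.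
by rewrite foldr_push_push // fg_wordP.
Qed.

Lemma fg_mul1 : left_id fg_one fg_mul.
Proof.
case=> s rs; apply: val_inj => /=.
elim: s rs => //= x s IHs rs; rewrite (IHs (path_sorted rs)).
by case: s rs {IHs} => //= y s /andP[/negPf->].
Qed.

Lemma fg_mulr1 : right_id fg_one fg_mul.
Proof. by move=> u; apply: val_inj. Qed.

Lemma fg_mulV : right_inverse fg_one fg_inv fg_mul.
Proof.
case=> s rs; apply: val_inj => /=.
elim: s rs => //= x s IHs rs.
by rewrite rev_cons foldr_rcons /= linvK eqxx (IHs (path_sorted rs)).
Qed.

Lemma fg_invK : involutive fg_inv.
Proof.
move=> u; apply: val_inj; rewrite /= map_rev revK.
by rewrite -map_comp map_id_in // => x _ /=; rewrite linvK.
Qed.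

Lemma fg_mulVg : left_inverse fg_one fg_inv fg_mul.
Proof. by move=> u; rewrite -{2}[u]fg_invK fg_mulV. Qed.

HB.instance Definition _ :=
  isGroup.Build free_group fg_mulA fg_mul1 fg_mulr1 fg_mulVg fg_mulV.

Local Open Scope group_scope.

Definition gen (a : X) : free_group := @FreeGroup [:: (a, false)] isT.
Definition lgen x : free_group := if x.2 then (gen x.1)^-1 else gen x.1.

Lemma fg_word_mul u x : fg_word (u * lgen x) = push x (fg_word u).
Proof. by case: x => a []. Qed.

Lemma fg_word_prod s : freduced s -> fg_word (\prod_(x <- s) lgen x) = rev s.
Proof.
elim/last_ind: s => [|s x IHs] rs; first by rewrite big_nil.
rewrite -cats1 big_cat big_seq1 fg_word_mul cats1.
have rs' : freduced s by move: rs; rewrite -cats1 => /cat_sorted2[].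
rewrite (IHs rs') rev_rcons.
case/lastP: s rs {IHs rs'} => // s y rs.
suff /negPf ne : x != linv y by rewrite rev_rcons /= linv_sym ne.
by move: rs; rewrite /freduced; case: s => [|z s] /=; rewrite ?rcons_path ?last_rcons => /andP[].
Qed.

Lemma prod_lgen_neq1 s : freduced s -> s <> [::] -> \prod_(x <- s) lgen x <> 1.
Proof. by move=> /fg_word_prod + ne e; rewrite e => /esym/(congr1 rev); rewrite revK. Qed.
End FreeGroup.

(** * Triangular systems of conjugation equations *)

Section ConjugationSystems.
Variables (X : choiceType) (R : rel X).
Hypothesis Rwf : well_founded R.

(* [rule x = Some (true, y, m)] demands [x * prod m = prod m * y] and
   [rule x = Some (false, y, m)] demands [y * prod m = prod m * x]. *)
Variable rule : X -> option (bool * X * seq X).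

Definition holds (E : X -> seq X -> X -> Prop) x :=
  if rule x is Some (b, y, m) then if b then E x m y else E y m x else True.

Hypothesis rule_lower : forall x b y m, rule x = Some (b, y, m) -> all (R^~ x) (y :: m).

Section Solution.
Local Open Scope group_scope.
Variables (G : groupType) (g : X -> G).

Let step x (f : X -> G) : G :=
  if rule x is Some (b, y, m) then
    let P := \prod_(z <- m) f z in if b then P * f y * P^-1 else P^-1 * f y * P
  else g x.

Let step_ext x f1 f2 : (forall y, R y x -> f1 y = f2 y) -> step x f1 = step x f2.
Proof.
move=> e; rewrite /step; case er: (rule x) => [[[b y] m]|//].
have /= /andP[/e-> /allP lm] := rule_lower er.
by rewrite (eq_big_seq _ (fun z zm => e z (lm z zm))).
Qed.

Lemma solution : exists f : X -> G,
  (forall x, rule x = None -> f x = g x) /\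
  forall x, holds (fun y m z => f y * \prod_(t <- m) f t = \prod_(t <- m) f t * f z) x.
Proof.
(* The recursive value exists only below [x]; by [rule_lower] the default [1] is never read. *)
pose F x (rec : forall y, R y x -> G) :=
  step x (fun y => if Bool.bool_dec (R y x) true is left yx then rec y yx else 1).
pose f := Fix Rwf (fun=> G) F.
have fE x : f x = step x f.
  rewrite /f Fix_eq => [|y u v uv]; apply: step_ext => z; case: Bool.bool_dec => //.
exists f; split=> x; first by rewrite fE /step => ->.
rewrite /holds; case er: (rule x) => [[[[] y] m]|//]; rewrite [f x]fE /step er.
  by rewrite -mulgA mulVg mulg1.
by rewrite !mulgA mulgV mul1g.
Qed.
End Solution.
End ConjugationSystems.

Section LexWf.
Variables (X : Type) (w f : X -> nat).
Definition lex x y := (w x < w y) || (w x == w y) && (f x < f y).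
Lemma lex_wf : well_founded lex.
Proof.
suff acc n m x : w x = n -> f x < m -> Acc lex x by move=> x; exact: acc (erefl _) (leqnn _).
elim/ltn_ind: n m x => n IHn; elim=> [|m IHm] x wx fx; first by [].
constructor=> y; case/orP=> [yx|/andP[/eqP yx fy]].
  by apply: (IHn (w y) _ (f y).+1); rewrite -?wx.
by apply: IHm; [rewrite yx | apply: leq_trans fy fx].
Qed.
End LexWf.

(** * Equations along a single line *)

Section Lines.
Variables (X : choiceType) (s s' : X -> X) (n : nat) (pos : X -> int).
Hypotheses (sK : cancel s s') (s'K : cancel s' s) (n_gt0 : 0 < n).
Hypothesis pos_s : forall x, pos (s x) = (pos x + 1)%R.

Definition determined x := (pos x < 0)%R || (n%:Z <= pos x)%R.
Definition between p := traject s (s p) n.-1.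
(** Terms before the window [0 <= pos x < n] are computed from the [n] terms that follow, those
    after it from the [n] preceding ones, so every rule points towards the window. *)
Definition line_rule x :=
  if (pos x < 0)%R then (true, iter n s x, between x)
  else (false, iter n s' x, between (iter n s' x)).

Lemma iterK m : cancel (iter m s) (iter m s').
Proof. by elim: m => // m IHm x; rewrite [iter _ s x]iterS iterSr sK. Qed.
Lemma iter'K m : cancel (iter m s') (iter m s).
Proof. by elim: m => // m IHm x; rewrite [iter _ s' x]iterS iterSr s'K. Qed.

Lemma pos_iter m x : pos (iter m s x) = (pos x + m%:Z)%R.
Proof. by clear n_gt0; elim: m => [|m IHm] /=; rewrite ?pos_s ?IHm; lia. Qed.

Lemma line_rule_lower x y : determined x ->
  y \in (line_rule x).1.2 :: (line_rule x).2 ->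
  exists2 t, 0 < t <= n & y = iter t (if (pos x < 0)%R then s else s') x.
Proof.
move=> dx; rewrite /line_rule; case: ifP => /= neg; rewrite inE => /orP[/eqP->|].
- by exists n; rewrite ?n_gt0 ?leqnn.
- case/trajectP=> i lti ->; exists i.+1; first lia.
  by rewrite -iterSr.
- by exists n; rewrite ?n_gt0 ?leqnn.
- case/trajectP=> i lti ->; rewrite -iterSr; exists (n - i.+1); first lia.
  have -> : n = i.+1 + (n - i.+1) by lia.
  by rewrite iterD iter'K addKn.
Qed.

(** The equation joining [p] to [iter n s p] is the rule of exactly one endpoint: of [p] when
    [pos p < 0], and otherwise of [iter n s p], whose position is then at least [n]. Abstracting [E]
    covers both equations in a group and closure conditions on a predicate. *)
Lemma line_ruleP (E : X -> seq X -> X -> Prop) :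
  (forall x, determined x -> let: (b, y, m) := line_rule x in if b then E x m y else E y m x) <->
  (forall p, E p (between p) (iter n s p)).
Proof.
clear n_gt0; rewrite /line_rule; split=> [H p|H x _]; last first.
  by case: ifP => _ //; have := H (iter n s' x); rewrite iter'K.
case: (boolP (pos p < 0)%R) => [neg|pge].
  by have := H p; rewrite /determined neg; apply.
have := H (iter n s p); rewrite /determined pos_iter.
have -> : (pos p + n%:Z < 0)%R = false by lia.
have -> : (n%:Z <= pos p + n%:Z)%R by lia.
by rewrite iterK; apply.
Qed.

End Lines.

(** * Lines in the dihedral Artin group *)

Section Runs.
Variable T : choiceType.
Implicit Types (s : seq (T * bool)) (i : T).

Definition run x s := find (predC1 x) s.
(** The exponent of the final power of [t_i]: at most one of the two runs is nonzero, and the head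
    of the list is the last letter. *)
Definition signed_run i s : int := ((run (i, false) s)%:Z - (run (i, true) s)%:Z)%R.
Fixpoint strip i s := if s is x :: s' then if x.1 == i then strip i s' else s else [::].

Lemma strip_push i b s : strip i (push (i, b) s) = strip i s.
Proof.
by case: s => [|y s] /=; rewrite ?eqxx //; case: (y =P _) => [->|_] /=; rewrite eqxx.
Qed.

Lemma run_linv x s : freduced (linv x :: s) -> run x s = 0.
Proof. by case: s => //= z s; rewrite /run /= /freduced /= linvK => /andP[->]. Qed.

Lemma run_cons x y s : run x (y :: s) = if y == x then (run x s).+1 else 0.
Proof. by rewrite /run /=; case: eqP. Qed.

Lemma signed_run_push i s : freduced s ->
  signed_run i (push (i, false) s) = (signed_run i s + 1)%R.
Proof.
have ft : ((i, false) == (i, true)) = false by rewrite xpair_eqE andbF.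
rewrite /signed_run; case: s => [|y s] rs; first by rewrite /push !run_cons eqxx ft.
rewrite /push; case: (y =P _) rs => [-> rs|/eqP ne _].
  by rewrite (run_linv rs) !run_cons eqxx eq_sym ft /=; lia.
by rewrite !(run_cons _ (i, false)) eqxx ft (run_cons (i, true)) (negPf ne); lia.
Qed.

End Runs.

Section Residues.
Variable k : nat.
Implicit Types (h : int) (s : seq ('I_k.+1 * bool)).

Definition res h : 'I_k.+1 := inord (absz (h %% k.+1)%Z).

Lemma res_period h : res (h + k.+1%:Z)%R = res h.
Proof. by rewrite /res modzDr. Qed.

Lemma res_ord (i : 'I_k.+1) : res i = i.
Proof. by apply: val_inj; rewrite /= inordK modz_nat absz_nat ?modn_small. Qed.

(** A step along [b] multiplies by [t_h^-1] and raises [h]. [desc] counts the successive steps along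
    [b] that shorten the word, [asc] those along [b^-1]; so [slope] is the signed distance on the
    line to its point closest to the root. *)
Fixpoint desc h s := if s is x :: s' then
  if x == (res h, false) then (desc (h + 1)%R s').+1 else 0 else 0.
Fixpoint asc h s := if s is x :: s' then
  if x == (res (h - 1)%R, true) then (asc (h - 1)%R s').+1 else 0 else 0.
Definition slope h s : int := ((asc h s)%:Z - (desc h s)%:Z)%R.

Lemma slope_push h s : freduced s ->
  slope (h + 1)%R (push (res h, true) s) = (slope h s + 1)%R.
Proof.
have hK : (h + 1 - 1)%R = h by lia.
have tf (a b : 'I_k.+1) : ((a, true) == (b, false)) = false by rewrite xpair_eqE andbF.
rewrite /slope; case: s => [|y s] rs; first by rewrite /= hK eqxx tf.
rewrite /push; case: (y =P _) rs => [-> rs|/eqP ne _].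
  have -> : asc (h + 1)%R s = 0.
    by case: s rs => //= z s; rewrite /freduced /= hK => /andP[/negPf->].
  by rewrite /= eq_sym tf eqxx; lia.
have -> : desc h (y :: s) = 0 by rewrite /= (negPf ne).
have -> : asc (h + 1)%R ((res h, true) :: y :: s) = (asc h (y :: s)).+1.
  by rewrite [LHS]/= hK eqxx.
by rewrite [desc (h + 1)%R _]/= tf; lia.
Qed.

Lemma res_succ h : 0 < k -> (res h == res (h + 1)%R) = false.
Proof.
move=> k0; apply/eqP=> /(congr1 (@nat_of_ord _)).
have bnd (z : int) : absz (z %% k.+1)%Z < k.+1 by have := ltz_pmod z (isT : (0 < k.+1%:Z)%R); lia.
rewrite /res !inordK // => e.
have : (h == h + 1 %[mod k.+1])%Z by apply/eqP; lia.
rewrite eqz_mod_dvd.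
have -> : (h - (h + 1) = - 1)%R by lia.
by rewrite dvdzE /= dvdn1; lia.
Qed.
End Residues.

(** * Coordinates on the dihedral Artin group *)

Section Dihedral.
Variable k : nat.
(* [(v, h)] stands for [v * x ^ h], where [x = a * b]. *)
Definition dihedral := (free_group 'I_k.+1 * int)%type.
HB.instance Definition _ := Choice.on dihedral.
Implicit Types d : dihedral.

Local Notation res := (@res k).
(** Right multiplications by [a] and [b] and their inverses, computed from [x^h a = t_h x^h] and
    [b = a^-1 x]. *)
Definition stepa d : dihedral := ((d.1 * gen (res d.2))%g, d.2).
Definition stepa' d : dihedral := ((d.1 * (gen (res d.2))^-1)%g, d.2).
Definition stepb d : dihedral := ((d.1 * (gen (res d.2))^-1)%g, (d.2 + 1)%R).
Definition stepb' d : dihedral := ((d.1 * gen (res (d.2 - 1)))%g, (d.2 - 1)%R).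

Lemma stepaK : cancel stepa stepa'.
Proof. by case=> v h; rewrite /stepa' /= mulgK. Qed.
Lemma stepa'K : cancel stepa' stepa.
Proof. by case=> v h; rewrite /stepa /= mulgVK. Qed.
Lemma stepbK : cancel stepb stepb'.
Proof. by case=> v h; rewrite /stepb' /= addrK mulgVK. Qed.
Lemma stepb'K : cancel stepb' stepb.
Proof. by case=> v h; rewrite /stepb /= mulgK subrK. Qed.

Definition origin : dihedral := (1%g, 0%R).

(** A step along [a] followed by one along [b] is multiplication by [x], so [P] does not depend on
    the exponent of [x]; setting this exponent to [i] makes the step along [a] append [t_i]. *)
Lemma dihedral_ind (P : dihedral -> Prop) : P origin ->
  (forall d, P d <-> P (stepa d)) -> (forall d, P d <-> P (stepb d)) -> forall d, P d.
Proof.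
move=> P1 Pa Pb.
have Pup v h : P (v, h) <-> P (v, (h + 1)%R).
  by rewrite (Pa (v, h)) (Pb (stepa (v, h))) /stepb /= mulgK.
have Pnat v h (j : nat) : P (v, h) <-> P (v, (h + j%:Z)%R).
  elim: j => [|j IHj]; first by rewrite addr0.
  by rewrite IHj Pup -addrA -[j.+1]addn1 PoszD.
have Ph v h h' : P (v, h) <-> P (v, h').
  have /orP[le|le] : ((h <= h') || (h' <= h))%R by lia.
    by rewrite (Pnat v h `|h' - h|%N); have -> : (h + `|h' - h|%N%:Z = h')%R by lia.
  by symmetry; rewrite (Pnat v h' `|h - h'|%N); have -> : (h' + `|h - h'|%N%:Z = h)%R by lia.
case=> -[s rs] h; elim: s rs h => [|[i e] s IHs] rs h.
  have -> : FreeGroup rs = 1%g by exact: val_inj.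
  by rewrite (Ph _ _ 0%R).
have rs' := path_sorted rs; pose v := FreeGroup rs'.
have -> : FreeGroup rs = (v * lgen (i, e))%g.
  apply: val_inj; apply: etrans (esym (fg_word_mul v (i, e))).
  by rewrite /= {v IHs} /push; case: s rs {rs'} => //= y t /andP[/negPf->].
have Pgen u : P (u, Posz i) <-> P ((u * gen i)%g, Posz i) by rewrite (Pa (u, _)) /stepa /= res_ord.
rewrite (Ph _ _ (Posz i)); case: e {rs} => /=; last by rewrite -Pgen; apply: IHs.
by rewrite Pgen mulgVK; apply: IHs.
Qed.

(* [f d], and any element satisfying [P] in the last clause, plays the role of
   the conjugate of [c] by [d]; a relation [f d * Q = Q * f d'] is the shift
   invariance of products of consecutive terms with the common factor [Q]
   isolated. That the free terms generate is phrased as an induction principle. *)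
Definition kernel_free l n := exists free : pred dihedral,
  (exists f : dihedral -> free_group dihedral,
    [/\ forall d, free d -> f d = gen d,
        forall d, (f d * \prod_(y <- between stepa l d) f y)%g
           = (\prod_(y <- between stepa l d) f y * f (iter l stepa d))%g
      & forall d, (f d * \prod_(y <- between stepb n d) f y)%g
           = (\prod_(y <- between stepb n d) f y * f (iter n stepb d))%g]) /\
  forall P : dihedral -> Prop, (forall d, free d -> P d) ->
    (forall d, (forall y, y \in between stepa l d -> P y) -> (P d <-> P (iter l stepa d))) ->
    (forall d, (forall y, y \in between stepb n d -> P y) -> (P d <-> P (iter n stepb d))) ->
    forall d, P d.

Lemma flat_kernel_free : kernel_free 1 1.
Proof.
exists (pred1 origin); split.
  exists (fun=> gen origin); split=> [d /eqP->//| |] d; by rewrite !big_nil mulg1 mul1g.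
move=> P P0 Pa Pb; apply: dihedral_ind => [|d|d].
- exact/P0/eqxx.
- exact: Pa.
- exact: Pb.
Qed.

(** * Choice of the windows and the recursion *)

Section Hyperbolic.
Variables l n : nat.
Hypotheses (k_gt0 : 0 < k) (l_gt0 : 0 < l) (n_gt1 : 1 < n).

(* Inverse letters weigh [n], so that leaving an inverse letter for up to [n - 1]
   positive ones still decreases the weight. *)
Definition weight (s : seq ('I_k.+1 * bool)) := \sum_(x <- s) (if x.2 then n else 1).

Lemma weight_cons x s : weight (x :: s) = (if x.2 then n else 1) + weight s.
Proof. exact: big_cons. Qed.

Lemma weight_strip i s : weight (strip i s) <= weight s.
Proof.
elim: s => //= x s IHs; rewrite weight_cons; case: ifP => _; rewrite ?weight_cons //.
exact: leq_trans IHs (leq_addl _ _).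
Qed.

Lemma weight_push x s : weight (push x s) <= (if x.2 then n else 1) + weight s.
Proof.
case: s => [|y s]; first by rewrite /= weight_cons.
by rewrite /push; case: ifP => _; rewrite !weight_cons // addnA leq_addl.
Qed.

Definition base d := strip (res d.2) (fg_word d.1).
(* On the lines along [a] whose base ends with [t_(h+1)], the second element may
   already be determined by its line along [b]; the window is then moved by one
   step to contain this element but not the base. *)
Definition shift d : nat :=
  if base d is x :: _ then x == (res (d.2 + 1)%R, false) else 0.
(* The free terms will be those with [0 <= posa d < l] and [0 <= posb d < n]. *)
Definition posa d : int := (signed_run (res d.2) (fg_word d.1) - (shift d)%:Z)%R.
Definition posb d : int := (slope d.2 (fg_word d.1) + n.-1%:Z)%R.

Lemma word_stepa d : fg_word (stepa d).1 = push (res d.2, false) (fg_word d.1).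
Proof. exact: (fg_word_mul d.1 (_, false)). Qed.
Lemma word_stepa' d : fg_word (stepa' d).1 = push (res d.2, true) (fg_word d.1).
Proof. exact: (fg_word_mul d.1 (_, true)). Qed.
Lemma word_stepb d : fg_word (stepb d).1 = push (res d.2, true) (fg_word d.1).
Proof. exact: (fg_word_mul d.1 (_, true)). Qed.
Lemma word_stepb' d : fg_word (stepb' d).1 = push (res (d.2 - 1)%R, false) (fg_word d.1).
Proof. exact: (fg_word_mul d.1 (_, false)). Qed.

Lemma base_stepa d : base (stepa d) = base d.
Proof. by rewrite /base word_stepa strip_push. Qed.
Lemma base_stepa' d : base (stepa' d) = base d.
Proof. by rewrite /base word_stepa' strip_push. Qed.

Lemma posa_stepa d : posa (stepa d) = (posa d + 1)%R.
Proof.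
rewrite /posa /shift base_stepa word_stepa signed_run_push ?fg_wordP //=; lia.
Qed.

Lemma posb_stepb d : posb (stepb d) = (posb d + 1)%R.
Proof. rewrite /posb word_stepb slope_push ?fg_wordP //=; lia. Qed.

Lemma base_iter_stepa m b d : base (iter m (if b then stepa else stepa') d) = base d.
Proof. by elim: m => //= m <-; case: b; rewrite ?base_stepa ?base_stepa'. Qed.

Lemma word_iter_stepb t d : t <= desc d.2 (fg_word d.1) ->
  fg_word (iter t stepb d).1 = drop t (fg_word d.1).
Proof.
elim: t d => [|t IHt] d; first by rewrite drop0.
rewrite iterSr => lt; have wE : fg_word (stepb d).1 = behead (fg_word d.1).
  by rewrite word_stepb; case: (fg_word d.1) lt => //= x s; case: eqP => // ->; rewrite eqxx.
rewrite IHt wE; first by rewrite -drop1 drop_drop addn1.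
by case: (fg_word d.1) lt => //= x s; case: eqP.
Qed.

Lemma weight_iter_stepb' t d : weight (fg_word (iter t stepb' d).1) <= t + weight (fg_word d.1).
Proof.
elim: t => // t IHt; rewrite iterS word_stepb'; apply: leq_trans (weight_push _ _) _ => /=; lia.
Qed.

Lemma res_pred h : (res (h - 1)%R == res h) = false.
Proof. by have := res_succ (h - 1)%R k_gt0; rewrite subrK. Qed.

Lemma sign_neq (a b : 'I_k.+1) : ((a, true) == (b, false)) = false.
Proof. by rewrite xpair_eqE andbF. Qed.

(** The offset [n.-1] makes the window along [b] end at the point closest to the root. Before it at
    least [n >= 2] steps still shorten the word, which gives the last two letters; after it the last
    letter is the inverse one appended by the preceding step. *)
Lemma detb_cases d : determined n posb d ->
  if (posb d < 0)%R then n <= desc d.2 (fg_word d.1) /\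
    exists u, fg_word d.1 = [:: (res d.2, false), (res (d.2 + 1)%R, false) & u]
  else exists u, fg_word d.1 = (res (d.2 - 1)%R, true) :: u.
Proof.
rewrite /determined /posb /slope.
case: (fg_word d.1) => [|x s]; first by rewrite /=; lia.
case: ifP => [neg _|].
  have ge : n <= desc d.2 (x :: s) by lia.
  split=> //; case: s ge {neg} => [|y s] /=; case: eqP => [->|]; try lia.
  by case: eqP => [->|]; [exists s | lia].
move=> nneg ge; exists s.
suff /eqP -> : x == (res (d.2 - 1)%R, true) by [].
by move: ge nneg => /=; case: (x =P (res (d.2 - 1), true)) => //= _; case: ifP => _; lia.
Qed.

(** The word ends either with [t_(h+1) t_h], where run 1 and shift 1 cancel, or with [t_(h-1)^-1],
    where both vanish; neighbouring residues differ as [k > 0]. Hence no element is outside both of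
    its windows. *)
Lemma detb_posa d : determined n posb d -> posa d = 0%R.
Proof.
move=> /detb_cases; rewrite /posa /shift /base /signed_run.
case: ifP => _ [].
  move=> _ [u ->]; rewrite !run_cons !xpair_eqE !eqxx !andbF andbT /= eqxx.
  by rewrite [res (_ + 1)%R == _]eq_sym (res_succ _ k_gt0) eqxx.
by move=> u ->; rewrite !run_cons !xpair_eqE res_pred /= res_pred sign_neq.
Qed.

(** Before the window, steps along [b] only delete letters, and the letter [t_(h+1)] ending the base
    is stripped or dropped. After it, the first step back removes an inverse letter of weight [n],
    and the at most [n - 1] others add weight at most 1 each. *)
Lemma detb_lower d t : determined n posb d -> 0 < t <= n ->
  weight (base (iter t (if (posb d < 0)%R then stepb else stepb') d)) < weight (base d).
Proof.
move=> /detb_cases; case: ifP => _ [].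
  move=> ge [u wE] /andP[t_gt0 tn].
  have hE : (iter t stepb d).2 = (d.2 + t%:Z)%R.
    by elim: (t) => [|j IHj] /=; rewrite ?IHj; lia.
  rewrite /base hE word_iter_stepb ?(leq_trans tn) // wE.
  have -> : strip (res d.2) [:: (res d.2, false), (res (d.2 + 1)%R, false) & u] =
            (res (d.2 + 1)%R, false) :: u.
    by rewrite /= eqxx eq_sym (res_succ _ k_gt0).
  rewrite weight_cons ltnS; case: t t_gt0 {tn hE} => // -[|t] _.
    by rewrite /= eqxx weight_strip.
  rewrite /= (leq_trans (weight_strip _ _)) // -{2}[u](cat_take_drop t).
  by rewrite /weight big_cat leq_addl.
move=> u wE /andP[t_gt0 tn].
have -> : base d = (res (d.2 - 1)%R, true) :: u by rewrite /base wE /= res_pred.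
apply: leq_ltn_trans (weight_strip _ _) _; rewrite weight_cons.
case: t t_gt0 tn => // t _ tn; rewrite iterSr.
apply: leq_ltn_trans (weight_iter_stepb' _ _) _; rewrite word_stepb' wE.
by rewrite /push /linv /= eqxx; lia.
Qed.

Let w d := weight (base d).
(** The distance to the window along [a] breaks ties in the order: [base] is constant on such a
    line, and at most [l] steps towards the window cannot overshoot it. *)
Let dist d : nat := if (posa d < 0)%R then absz (posa d)
  else if (l%:Z <= posa d)%R then absz (posa d - l%:Z + 1)%R else 0.

Let rule d : option (bool * dihedral * seq dihedral) :=
  if determined l posa d then Some (line_rule stepa stepa' l posa d)
  else if determined n posb d then Some (line_rule stepb stepb' n posb d) else None.

Let rule_lower d b y m : rule d = Some (b, y, m) -> all ((lex w dist)^~ d) (y :: m).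
Proof.
rewrite /rule; case: ifP => [da [e]|_]; last case: ifP => [db [e]|//].
  apply/allP=> z zm.
  have [|t tl zE] := @line_rule_lower _ _ _ l posa stepa'K l_gt0 d z da; first by rewrite e.
  rewrite /lex /w {1 2}zE base_iter_stepa ltnn eqxx /=.
  have : posa z = (if (posa d < 0) then posa d + t%:Z else posa d - t%:Z)%R.
    rewrite zE; case: ifP => _; first exact: (pos_iter posa_stepa).
    by rewrite -{2}[d](iter'K stepa'K t) (pos_iter posa_stepa); lia.
  by move: tl da; rewrite /determined /dist; do ![case: ifP => ?]; lia.
apply/allP=> z zm.
have [|t tl zE] := @line_rule_lower _ _ _ n posb stepb'K (ltnW n_gt1) d z db; first by rewrite e.
by rewrite /lex {1}/w zE detb_lower.
Qed.

Lemma hyperbolic_kernel_free : kernel_free l n.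
Proof.
(* [rule] tries the line along [a] first; this ensures that no equation along [b] is lost. *)
have excl d : determined n posb d -> determined l posa d = false.
  by move=> /detb_posa e; rewrite /determined e; lia.
exists (fun d => rule d == None); split.
  have [f [fg fr]] := solution (@lex_wf _ w dist) rule_lower (@gen dihedral).
  pose E x (s : seq dihedral) z :=
    (f x * \prod_(t <- s) f t)%g = (\prod_(t <- s) f t * f z)%g.
  exists f; split=> [d /eqP/fg //| |].
    apply/(line_ruleP l stepaK stepa'K posa_stepa E) => d da.
    by have := fr d; rewrite /holds /rule da; case: line_rule => [[]].
  apply/(line_ruleP n stepbK stepb'K posb_stepb E) => d db.
  by have := fr d; rewrite /holds /rule db excl //; case: line_rule => [[]].
move=> P Pfree Pa Pb; elim/(well_founded_ind (@lex_wf _ w dist)) => d IHd.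
case er : (rule d) (@rule_lower d) => [[[b y] m]|]; last by move=> _; apply: Pfree; rewrite er.
move=> /(_ _ _ _ (erefl _)) /allP lowP.
have {lowP} : P y /\ forall z, z \in m -> P z.
  split; first by apply/IHd/lowP; rewrite inE eqxx.
  by move=> z zm; apply/IHd/lowP; rewrite inE zm orbT.
(* The closure hypotheses get the shape of the equations, so that [line_ruleP] applies to them
   too. *)
pose E x (s : seq dihedral) z := (forall t, t \in s -> P t) -> (P x <-> P z).
suff : if b then E d m y else E y m d by rewrite /E; case: b {er} => H [Py Pm]; apply/H.
move: er; rewrite /rule; case: ifP => [da [e]|_]; last case: ifP => [db [e]|//].
  by have /(line_ruleP l stepaK stepa'K posa_stepa E)/(_ d da) := Pa; rewrite e.
by have /(line_ruleP n stepbK stepb'K posb_stepb E)/(_ d db) := Pb; rewrite e.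
Qed.
End Hyperbolic.
End Dihedral.

(** * Words modulo the Artin relations *)

Definition power (T : Type) n (w : seq T) := flatten (nseq n w).

Lemma powerS T n (w : seq T) : power n.+1 w = w ++ power n w. Proof. by []. Qed.
Lemma powerSr T n (w : seq T) : power n.+1 w = power n w ++ w.
Proof. by elim: n => [|n IHn]; rewrite powerS ?cats0 // {1}IHn catA. Qed.
Lemma power_shift T n (u v : seq T) : u ++ power n (v ++ u) = power n (u ++ v) ++ u.
Proof. by elim: n => [|n IHn]; rewrite ?cats0 // !powerS -!catA IHn. Qed.

Lemma alt_double (V : Type) n (u v : V) : alt n.*2 u v = power n [:: (u, false); (v, false)].
Proof.
elim: n => // n IHn; rewrite powerS -IHn /alt /mkseq doubleS /= -[2]addn0 iotaDl -map_comp.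
congr [:: _, _ & _]; apply: eq_map => i /=; by rewrite negbK.
Qed.

Section WordGroup.
Variables (V : Type) (edge : V -> V -> Prop) (m : V -> V -> nat).
Local Notation "u =w v" := (artin_eq edge m u v) (at level 70).
Implicit Types u v w : word V.

#[local] Instance artin_equiv : Equivalence (artin_eq edge m).
Proof. by split; [exact: ae_refl | exact: ae_sym | exact: ae_trans]. Qed.

#[local] Hint Resolve ae_refl : core.

Lemma artin_ctx u v x y : x =w y -> u ++ x ++ v =w u ++ y ++ v.
Proof.
elim=> {x y} [w|x y _ IH|x y z _ IHx _ IHy|x y g e|x y g h gh].
- exact: ae_refl.
- exact: ae_sym.
- exact: ae_trans IHx IHy.
- by have := ae_cancel edge m (u ++ x) (y ++ v) g e; rewrite -!catA.
- by have := ae_rel m (u ++ x) (y ++ v) gh; rewrite -!catA.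
Qed.

#[local] Instance cat_proper :
  Proper (artin_eq edge m ==> artin_eq edge m ==> artin_eq edge m) (@cat (V * bool)).
Proof.
move=> x x' xx y y' yy; transitivity (x' ++ y); first exact: (artin_ctx [::] y xx).
by have := artin_ctx x' [::] yy; rewrite !cats0.
Qed.

Lemma winv_cat u v : winv (u ++ v) = winv v ++ winv u.
Proof. by rewrite /winv map_cat rev_cat. Qed.
Lemma winvK : involutive (@winv V).
Proof.
move=> w; rewrite /winv map_rev revK -map_comp -[RHS]map_id.
by apply: eq_map => -[x e] /=; rewrite negbK.
Qed.

Lemma mulwV w : w ++ winv w =w [::].
Proof.
elim/last_ind: w => [|w [x e] IHw]; first exact: ae_refl.
rewrite -cats1 winv_cat -catA /=.
exact: ae_trans (ae_cancel _ _ w (winv w) x e) IHw.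
Qed.
Lemma mulVw w : winv w ++ w =w [::].
Proof. by rewrite -{2}[w]winvK mulwV. Qed.
Lemma mulwKV u w : u ++ winv w ++ w =w u.
Proof. by rewrite mulVw cats0. Qed.
Lemma mulKw u w : winv w ++ w ++ u =w u.
Proof. by rewrite catA mulVw. Qed.
Lemma mulVKw u w : w ++ winv w ++ u =w u.
Proof. by rewrite catA mulwV. Qed.

Lemma mulwI w u v : w ++ u =w w ++ v -> u =w v.
Proof. by move=> e; rewrite -(mulKw u w) e mulKw. Qed.
Lemma mulIw w u v : u ++ w =w v ++ w -> u =w v.
Proof.
by move=> e; rewrite -[u]cats0 -(mulwV w) catA e -catA mulwV cats0.
Qed.

#[local] Instance winv_proper : Proper (artin_eq edge m ==> artin_eq edge m) (@winv V).
Proof. by move=> u v uv; apply: (@mulIw u); rewrite mulVw uv mulVw. Qed.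

Section Action.
Variables (X : Type) (st : V * bool -> X -> X).
Definition act (w : word V) x := foldl (fun y p => st p y) x w.

Lemma act_cat u v x : act (u ++ v) x = act v (act u x).
Proof. exact: foldl_cat. Qed.
Lemma act_power n w x : act (power n w) x = iter n (act w) x.
Proof. by elim: n x => // n IHn x; rewrite powerS act_cat IHn -iterSr. Qed.

Hypothesis stK : forall (g : V) e, cancel (st (g, e)) (st (g, ~~ e)).

Lemma act_winvK w : cancel (act w) (act (winv w)).
Proof.
elim/last_ind: w => // w [v e] IHw x.
by rewrite -cats1 winv_cat !act_cat /= stK IHw.
Qed.
Lemma act_winv_can w : cancel (act (winv w)) (act w).
Proof. by move=> x; rewrite -{1}[w]winvK act_winvK. Qed.

Hypothesis st_rel : forall u v : V, edge u v -> act (alt (m u v) u v) =1 act (alt (m u v) v u).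

Lemma act_eq u v : u =w v -> act u =1 act v.
Proof.
elim=> {u v} [w|x y _ IH|x y z _ IHx _ IHy|x y g e|x y g h gh] t //.
- by rewrite IHx.
- by rewrite !act_cat /= stK.
- by rewrite !act_cat st_rel.
Qed.
End Action.

Section FreeTest.
Variables (I : choiceType) (free : pred I) (tau : I -> word V) (H : word V -> Prop).
Let letters (l : seq (I * bool)) := [seq (tau p.1, p.2) | p <- l].
Local Notation ev := (eval_word (@cat (V * bool)) (@winv V) [::]).

Lemma eval_cat l1 l2 : ev (l1 ++ l2) = ev l1 ++ ev l2.
Proof. by elim: l1 => //= p l1 IHl; rewrite [LHS]/= -/(ev _) IHl -catA. Qed.

Lemma eval_letter (w : word V) e : ev [:: (w, e)] = if e then winv w else w.
Proof. by rewrite /= cats0. Qed.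

Lemma lift_letters (l : seq (word V * bool)) :
  (forall p, List.In p l -> exists2 i, free i & p.1 = tau i) ->
  exists2 l', l = letters l' & all (fun p => free p.1) l'.
Proof.
elim: l => [|[w e] l IHl] Hl; first by exists [::].
have [i fi /= ->] := Hl _ (or_introl (erefl _)).
have [l' -> al] := IHl (fun p pl => Hl p (or_intror pl)).
by exists ((i, e) :: l') => //=; rewrite fi.
Qed.

(** Adjacent letters with equal index and opposite signs would form a pair excluded by
    [reduced_mod], their representatives lying in one coset. *)
Lemma reduced_letters (l : seq (I * bool)) : (forall i, H (winv (tau i) ++ tau i)) ->
  reduced_mod (@cat (V * bool)) (@winv V) H (letters l) -> freduced l.
Proof.
move=> H1; elim: l => // -[i e] [//|[j e'] l] IHl /= [ne /IHl rl].
apply/andP; split=> //; apply/eqP=> -[ij ee]; apply: ne; split=> //=.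
by rewrite ij.
Qed.

End FreeTest.
End WordGroup.

#[local] Hint Resolve ae_refl : core.

#[local] Existing Instance artin_equiv.
#[local] Existing Instance cat_proper.
#[local] Existing Instance winv_proper.

Lemma iter_skew (D : Type) (G : groupType) (s : D -> D) (f : D -> G) (phi : D * G -> D * G) :
  (forall d y, phi (d, y) = (s d, (y * f d)%g)) ->
  forall j d y, iter j phi (d, y) = (iter j s d, (y * \prod_(z <- traject s d j) f z)%g).
Proof.
move=> phiE; elim=> [|j IHj] d y; first by rewrite big_nil mulg1.
by rewrite iterSr phiE IHj /= -iterS iterSr big_cons mulgA.
Qed.

(** * The triangle group *)

Section Triangle.
Variables (V : eqType) (edge : V -> V -> Prop) (m : V -> V -> nat) (a b c : V) (k l n : nat).
Hypotheses (abcP : forall v, v \in [:: a; b; c]) (abc_uniq : uniq [:: a; b; c]).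
Hypotheses (edge_neq : forall u v, edge u v -> u != v).
Hypotheses (edge_ab : edge a b) (edge_ac : edge a c) (edge_bc : edge b c).
Hypotheses (m_sym : forall u v, m u v = m v u).
Hypotheses (m_ab : m a b = k.+1.*2) (m_ac : m a c = l.*2) (m_bc : m b c = n.*2).
Hypotheses (l_gt0 : 0 < l) (n_gt0 : 0 < n).
Local Notation "u =w v" := (artin_eq edge m u v) (at level 70).
Local Notation D := (dihedral k).
Implicit Types (d : D) (w : word V).

Let A : word V := [:: (a, false)].
Let B : word V := [:: (b, false)].
Let C : word V := [:: (c, false)].

Let ne_ba : (b == a) = false.
Proof. by case/and3P: abc_uniq; rewrite !inE negb_or eq_sym => /andP[/negPf]. Qed.
Let ne_ca : (c == a) = false.
Proof. by case/and3P: abc_uniq; rewrite !inE negb_or andbC eq_sym => /andP[/negPf]. Qed.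
Let ne_cb : (c == b) = false.
Proof. by case/and3P: abc_uniq => _; rewrite !inE eq_sym => /negPf. Qed.

Definition dstep (p : V * bool) d : D :=
  if p.1 == a then if p.2 then stepa' d else stepa d
  else if p.1 == b then if p.2 then stepb' d else stepb d
  else d.

Lemma dstepK v e : cancel (dstep (v, e)) (dstep (v, ~~ e)).
Proof.
move=> d; rewrite /dstep /=; case: (v == a); last case: (v == b) => //.
  by case: e; rewrite ?(@stepaK k) ?(@stepa'K k).
by case: e; rewrite ?(@stepbK k) ?(@stepb'K k).
Qed.

(** * The action on D x F(D) *)

Section Extension.
Variable f : D -> free_group D.

Definition fstep (p : V * bool) (x : D * free_group D) :=
  (dstep p x.1, if p.1 == c then (x.2 * if p.2 then (f x.1)^-1 else f x.1)%g else x.2).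

Lemma fstepK v e : cancel (fstep (v, e)) (fstep (v, ~~ e)).
Proof.
case=> d y; rewrite /fstep /= dstepK; case: eqP => // ->.
by rewrite /dstep /= ne_ca ne_cb; case: e; rewrite /= ?mulgVK ?mulgK.
Qed.

Lemma act_fst w x : (act fstep w x).1 = act dstep w x.1.
Proof. by elim: w x => //= p w IHw x; rewrite IHw. Qed.

Hypothesis rel_a : forall d, (f d * \prod_(y <- between (@stepa k) l d) f y)%g
           = (\prod_(y <- between (@stepa k) l d) f y * f (iter l (@stepa k) d))%g.
Hypothesis rel_b : forall d, (f d * \prod_(y <- between (@stepb k) n d) f y)%g
           = (\prod_(y <- between (@stepb k) n d) f y * f (iter n (@stepb k) d))%g.

(** Acting by [(ab)^j] fixes [v] and adds [j] to [h]; [(ba)^j] moreover multiplies [v] by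
    [t_h^-1 t_(h+j)], which is trivial for [j = k+1]. *)
Lemma fstep_rel_ab : act fstep (power k.+1 (A ++ B)) =1 act fstep (power k.+1 (B ++ A)).
Proof.
case=> -[v h] y; rewrite !act_power.
have abE j : iter j (act fstep (A ++ B)) ((v, h), y) = ((v, (h + j%:Z)%R), y).
  elim: j => [|j IHj]; first by rewrite /= addr0.
  rewrite iterS IHj /= /fstep /dstep /= !eqxx ne_ba [a == c]eq_sym ne_ca [b == c]eq_sym ne_cb.
  by rewrite /stepb /= mulgK -addrA -[j.+1]addn1 PoszD.
have baE j : iter j (act fstep (B ++ A)) ((v, h), y) =
    ((v * (gen (res k h))^-1 * gen (res k (h + j%:Z)%R), (h + j%:Z)%R), y)%g.
  elim: j => [|j IHj]; first by rewrite /= addr0 mulgVK.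
  rewrite iterS IHj /= /fstep /dstep /= !eqxx ne_ba [a == c]eq_sym ne_ca [b == c]eq_sym ne_cb.
  by rewrite /stepb /stepa /= mulgK -addrA -[j.+1]addn1 PoszD.
by rewrite abE baE res_period mulgVK.
Qed.

(** The two sides multiply the second coordinate by the products of [f] over [s d, ..., s^j d] and
    over [d, ..., s^(j-1) d]. Isolating the common factor leaves the assumed equation. *)
Lemma fstep_rel_c g (s : D -> D) j : g != c -> 0 < j -> (forall d, dstep (g, false) d = s d) ->
  (forall d, (f d * \prod_(y <- between s j d) f y)%g
           = (\prod_(y <- between s j d) f y * f (iter j s d))%g) ->
  act fstep (power j [:: (g, false); (c, false)]) =1
  act fstep (power j [:: (c, false); (g, false)]).
Proof.
move=> /negPf gc j_gt0 sE sf [d y]; rewrite !act_power.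
have cE u : dstep (c, false) u = u by rewrite /dstep /= ne_ca ne_cb.
rewrite (iter_skew (s := s) (f := f \o s)) => [|u z]; last first.
  by rewrite /= /fstep /= sE cE gc eqxx.
rewrite (iter_skew (s := s) (f := f)) => [|u z]; last first.
  by rewrite /= /fstep /= sE cE gc eqxx.
congr (_, (_ * _)%g); case: j j_gt0 sf => // j _ /(_ d) sf; rewrite /between [j.+1.-1]/= in sf.
rewrite [RHS]big_cons sf.
have -> : traject s d j.+1 = rcons (traject s d j) (iter j s d) by rewrite trajectSr.
rewrite -cats1 big_cat big_seq1 /=; congr (_ * _)%g.
by elim: (j) (d) => [|i IHi] u; rewrite ?big_nil // /= !big_cons IHi.
Qed.

Lemma fstep_rel u v : edge u v ->
  act fstep (alt (m u v) u v) =1 act fstep (alt (m u v) v u).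
Proof.
have ab x : act fstep (alt (m a b) a b) x = act fstep (alt (m a b) b a) x.
  by rewrite m_ab !alt_double fstep_rel_ab.
have ac x : act fstep (alt (m a c) a c) x = act fstep (alt (m a c) c a) x.
  rewrite m_ac !alt_double (@fstep_rel_c _ (@stepa k)) // 1?eq_sym ?ne_ca // => d.
  by rewrite /dstep eqxx.
have bc x : act fstep (alt (m b c) b c) x = act fstep (alt (m b c) c b) x.
  rewrite m_bc !alt_double (@fstep_rel_c _ (@stepb k)) // 1?eq_sym ?ne_cb // => d.
  by rewrite /dstep ne_ba eqxx.
move=> /edge_neq; have := abcP u; have := abcP v; rewrite !inE.
case/or3P=> /eqP-> /or3P[]/eqP-> uv x; rewrite ?eqxx // in uv *;
by rewrite ?ab ?ac ?bc // m_sym ?ab ?ac ?bc.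
Qed.

Lemma act_fstep_eq u v : u =w v -> act fstep u =1 act fstep v.
Proof. exact/act_eq/fstep_rel/fstepK. Qed.

Lemma act_dstep_eq u v : u =w v -> act dstep u =1 act dstep v.
Proof.
by move=> uv d; rewrite -(act_fst u (d, 1%g)) -(act_fst v (d, 1%g)) (act_fstep_eq uv).
Qed.
End Extension.

(** * A section of the retraction onto D *)

Local Notation ev := (eval_word (@cat (V * bool)) (@winv V) [::]).
Let x : word V := A ++ B.
Definition tau (i : 'I_k.+1) : word V := power i x ++ A ++ winv (power i x).
Definition tau_word (s : seq ('I_k.+1 * bool)) : word V :=
  ev [seq (tau p.1, p.2) | p <- rev s].
Definition xpow (h : int) : word V :=
  match h with Posz j => power j x | Negz j => winv (power j.+1 x) end.
Definition sigma d : word V := tau_word (fg_word d.1) ++ xpow d.2.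

Lemma xpowS h : xpow (h + 1)%R =w xpow h ++ x.
Proof.
case: h => [j|[|j]].
- by rewrite -PoszD addn1 /= powerSr.
- by change ([::] =w winv (x ++ [::]) ++ x); rewrite cats0 mulVw.
- have -> : (Negz j.+1 + 1 = Negz j)%R by lia.
  by rewrite [xpow (Negz j.+1)]/= -/x (powerS j.+1) winv_cat -catA mulwKV.
Qed.

Lemma xpowD h (j : nat) : xpow (h + j%:Z)%R =w xpow h ++ power j x.
Proof.
elim: j => [|j IHj]; first by rewrite addr0 cats0.
by rewrite -[j.+1]addn1 PoszD addrA xpowS IHj addn1 powerSr catA.
Qed.

Lemma rel_words u v j : edge u v -> m u v = j.*2 ->
  power j [:: (u, false); (v, false)] =w power j [:: (v, false); (u, false)].
Proof.
by move=> uv mj; have := ae_rel m [::] [::] uv; rewrite mj !alt_double !cats0.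
Qed.

Lemma A_central : A ++ power k.+1 x =w power k.+1 x ++ A.
Proof. by rewrite /x -(power_shift k.+1 A B) (rel_words edge_ab m_ab). Qed.

(** For [0 <= h <= k] this unfolds [tau]; it persists under shifts of [h] by [k+1] because [x^(k+1)]
    commutes with [a]. *)
Lemma tau_xpow h : tau (res k h) ++ xpow h =w xpow h ++ A.
Proof.
pose Q h := tau (res k h) ++ xpow h =w xpow h ++ A.
have Qord (i : 'I_k.+1) : Q (Posz i).
  by rewrite /Q res_ord /tau -!catA [xpow _]/= mulVw cats0.
have Qshift z : Q z <-> Q (z + k.+1%:Z)%R.
  rewrite /Q res_period xpowD; move: (power k.+1 x) A_central => P AP.
  split=> [e|]; first by rewrite (catA (tau _)) e -catA AP catA.
  by rewrite -(catA _ P A) -AP !catA => /mulIw.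
have Qiter z (j : nat) : Q z <-> Q (z + (j * k.+1)%N%:Z)%R.
  elim: j => [|j IHj]; first by rewrite addr0.
  by rewrite IHj Qshift mulSn addnC PoszD addrA.
have lt : `|(h %% k.+1)%Z|%N < k.+1 by have := ltz_pmod h (isT : (0 < k.+1%:Z)%R); lia.
have := Qord (Ordinal lt); rewrite /=.
have := divz_eq h k.+1; set r := (h %% k.+1)%Z; set q := (h %/ k.+1)%Z => hE.
have r0 : (0 <= r)%R by exact: modz_ge0.
have -> : Posz `|r|%N = r by lia.
rewrite -/(Q h) hE; case: q {hE} => q.
  by rewrite (Qiter r q) addrC PoszM.
move=> Qr; rewrite (Qiter _ q.+1).
by have -> : (Negz q * k.+1 + r + (q.+1 * k.+1)%N%:Z = r)%R by rewrite NegzE PoszM mulNr; lia.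
Qed.

Lemma tau_word_push p s : tau_word (push p s) =w
  tau_word s ++ (if p.2 then winv (tau p.1) else tau p.1).
Proof.
have consE q t : tau_word (q :: t) = tau_word t ++ (if q.2 then winv (tau q.1) else tau q.1).
  by rewrite /tau_word rev_cons map_rcons -cats1 eval_cat eval_letter.
case: s => [|q s]; first by rewrite consE.
rewrite /push; case: eqP => [->|_]; rewrite !consE // -catA /=.
by case: p.2; rewrite /= ?mulVw ?mulwV cats0.
Qed.

Lemma sigma_stepa d : sigma (stepa d) =w sigma d ++ A.
Proof. by rewrite /sigma word_stepa tau_word_push -(catA (tau_word _)) tau_xpow catA. Qed.

Lemma sigma_stepb d : sigma (stepb d) =w sigma d ++ B.
Proof.
rewrite /sigma word_stepb tau_word_push xpowS -!(catA (tau_word _)).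
apply: (mulwI (w := winv (tau_word (fg_word d.1)))); rewrite !mulKw.
apply: (mulwI (w := tau (res k d.2))); rewrite mulVKw.
by rewrite (catA (tau _)) tau_xpow -catA.
Qed.

Definition conj_c d : word V := sigma d ++ C ++ winv (sigma d).

(** The products of [j] consecutive conjugates from [d] and from [s d] agree: multiplied on the
    right by [sigma d U^(j+1)], both become [sigma d (C U)^j U], by the relation. Their overlap is
    the factor [between]. *)
Lemma conj_c_line (s : D -> D) g j : (forall d, sigma (s d) =w sigma d ++ [:: (g, false)]) ->
  power j [:: (g, false); (c, false)] =w power j [:: (c, false); (g, false)] -> 0 < j ->
  forall d, conj_c d ++ flatten (map conj_c (between s j d)) =w
    flatten (map conj_c (between s j d)) ++ conj_c (iter j s d).
Proof.
set U := [:: (g, false)] => sE rel j_gt0 d.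
(* The inner conjugators telescope. *)
have prefix i u : flatten (map conj_c (traject s u i)) ++ sigma u ++ power i U =w
    sigma u ++ power i (C ++ U).
  elim: i u => [|i IHi] u; first by rewrite /= !cats0.
  change ((conj_c u ++ flatten (map conj_c (traject s (s u) i))) ++ sigma u ++ U ++ power i U
    =w sigma u ++ (C ++ U) ++ power i (C ++ U)).
  rewrite -(catA (conj_c u)) (catA (sigma u) U) -sE IHi sE /conj_c.
  by move: (sigma u) (power i _) => S P; rewrite -!catA mulKw.
have shift : flatten (map conj_c (traject s d j)) =w flatten (map conj_c (traject s (s d) j)).
  apply: (mulIw (w := sigma d ++ power j.+1 U)).
  rewrite {1}powerSr powerS (catA (sigma d) U) -sE (prefix j (s d)) sE.
  rewrite (catA (sigma d)) (catA (flatten _)) (prefix j d) -!(catA (sigma d)).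
  by rewrite (power_shift j U C) (rel : power j (U ++ C) =w power j (C ++ U)).
case: j j_gt0 shift {rel} => // j _.
rewrite /between (trajectSr _ (s d)) [j.+1.-1]/= map_rcons => sh.
have -> : conj_c d ++ flatten (map conj_c (traject s (s d) j)) =
  flatten (map conj_c (traject s d j.+1)) by [].
by rewrite sh -cats1 flatten_cat /= cats0 -iterS iterSr.
Qed.

(** * The subgroups of the series *)

Definition letter_height (p : V * bool) : int :=
  if p.1 == b then (if p.2 then - 1 else 1)%R else 0%R.
Definition height w : int := (\sum_(p <- w) letter_height p)%R.

Lemma height_cat u v : height (u ++ v) = (height u + height v)%R.
Proof. exact: big_cat. Qed.

Lemma act_height w d : (act dstep w d).2 = (d.2 + height w)%R.
Proof.
elim: w d => [|p w IHw] d; first by rewrite /height big_nil addr0.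
rewrite /= IHw /height big_cons addrA; congr (_ + _)%R; rewrite /dstep /letter_height.
case: p => v e /=; case: (v =P a) => [->|_]; last by case: (v == b); [case: e | rewrite addr0].
by rewrite [a == b]eq_sym ne_ba addr0; case: e.
Qed.

(** The constant function 1 solves the equations required of [f]. *)
Lemma dstep_eq u v : u =w v -> act dstep u =1 act dstep v.
Proof. by apply: (@act_dstep_eq (fun=> 1%g)) => d; rewrite !big1 ?mulg1. Qed.

Lemma height_eq u v : u =w v -> height u = height v.
Proof. by move=> /dstep_eq/(_ (origin k)) e; have := congr1 snd e; rewrite !act_height !add0r. Qed.

Lemma height_winv w : height (winv w) = (- height w)%R.
Proof.
have := height_eq (mulwV edge m w).
by rewrite height_cat [height [::]]big_nil => /eqP; rewrite addrC addr_eq0 => /eqP.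
Qed.

Lemma act_tau i v : act dstep (tau i) (v, 0%R) = ((v * gen i)%g, 0%R).
Proof.
have actx j u : act dstep (power j x) (u, 0%R) = (u, Posz j).
  rewrite act_power; elim: j => [|j IHj] //; rewrite iterS IHj /= /dstep /= eqxx ne_ba eqxx.
  by rewrite /stepb /= mulgK -[j.+1]addn1 PoszD.
rewrite /tau !act_cat actx /= /dstep /= eqxx /stepa /= res_ord.
by rewrite -(actx i) (act_winvK dstepK).
Qed.

Lemma act_sigma d : act dstep (sigma d) (origin k) = d.
Proof.
elim/dihedral_ind: d => [//|d|d].
  rewrite (dstep_eq (sigma_stepa d)) act_cat /= /dstep /= eqxx.
  by split=> [->|/(can_inj (@stepaK k))].
rewrite (dstep_eq (sigma_stepb d)) act_cat /= /dstep /= ne_ba eqxx.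
by split=> [->|/(can_inj (@stepbK k))].
Qed.

Local Notation subgroup := (is_subgroup (artin_eq edge m) (@cat (V * bool)) (@winv V) [::]).

(** Reading the word from the left, [sigma] absorbs the letters [a] and [b], while
    [sigma d c = c_d sigma d] moves each [c] into [H]. This is applied to the whole kernel and to
    the subgroup generated by the free conjugates. *)
Lemma decomposition (H : word V -> Prop) w : subgroup H -> (forall d, H (conj_c d)) ->
  exists2 u, H u & w =w u ++ sigma (act dstep w (origin k)).
Proof.
case=> Heq H1 HM HV Hc; elim/last_ind: w => [|w [v e] [u Hu wE]]; first by exists [::].
set d := act dstep w (origin k) in wE.
have -> : act dstep (rcons w (v, e)) (origin k) = dstep (v, e) d by rewrite -cats1 act_cat.
rewrite -cats1; have := abcP v; rewrite !inE /dstep /= => /or3P[]/eqP->.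
- exists u => //; rewrite eqxx wE; case: e.
    by rewrite -{1}(stepa'K d) sigma_stepa -!catA; rewrite (mulwV _ _ A) cats0.
  by rewrite sigma_stepa catA.
- exists u => //; rewrite ne_ba eqxx wE; case: e.
    by rewrite -{1}(stepb'K d) sigma_stepb -!catA; rewrite (mulwV _ _ B) cats0.
  by rewrite sigma_stepb catA.
- rewrite ne_ca ne_cb; exists (u ++ if e then winv (conj_c d) else conj_c d).
    by apply: HM => //; case: e; [exact/HV | exact: Hc].
  rewrite wE /conj_c; move: (sigma d) => S; case: e; rewrite ?winv_cat ?winvK -!catA mulVw cats0 //.
Qed.

(** The kernel of the retraction onto D, which acts on itself by right multiplication. *)
Definition trivial_on_dihedral w := act dstep w =1 id.

Lemma trivial_subgroup : subgroup trivial_on_dihedral.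
Proof.
split=> [u v uv Hu d | // | u v Hu Hv d | u Hu d].
- by rewrite -(dstep_eq uv).
- by rewrite act_cat Hu Hv.
- by rewrite -{1}[d]Hu (act_winvK dstepK).
Qed.

Lemma conj_c_trivial d : trivial_on_dihedral (conj_c d).
Proof.
have actC u : act dstep C u = u by rewrite /= /dstep /= ne_ca ne_cb.
move=> u; rewrite /conj_c; move: (sigma d) => S.
by rewrite !act_cat actC (act_winvK dstepK).
Qed.

Lemma trivial_normal u w : trivial_on_dihedral w -> trivial_on_dihedral ((winv u ++ w) ++ u).
Proof. by move=> Hw d; rewrite !act_cat Hw (act_winv_can dstepK). Qed.

Lemma act_tau_letters (s : seq ('I_k.+1 * bool)) v :
  act dstep (ev [seq (tau p.1, p.2) | p <- s]) (v, 0%R) = ((v * \prod_(p <- s) lgen p)%g, 0%R).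
Proof.
elim: s v => [|[i e] s IHs] v; first by rewrite big_nil mulg1.
rewrite [ev _]/= act_cat big_cons mulgA -IHs; congr (act _ _ _).
case: e; last exact: act_tau.
by have := act_winvK dstepK (tau i) ((v * (gen i)^-1)%g, 0%R); rewrite act_tau mulgVK.
Qed.

Definition cfree w := all (fun p => p.1 != c) w.

Lemma cfree_winv w : cfree w -> cfree (winv w).
Proof. by rewrite /cfree /winv all_rev all_map. Qed.

Lemma cfree_sigma d : cfree (sigma d).
Proof.
have fA : cfree A by rewrite /cfree /= eq_sym ne_ca.
have fx j : cfree (power j x).
  elim: j => // j IHj; rewrite powerS /cfree all_cat -/(cfree _) -/(cfree _) IHj.
  by rewrite /cfree /= eq_sym ne_ca eq_sym ne_cb.
have ftau i : cfree (tau i) by rewrite /tau /cfree !all_cat -!/(cfree _) fx fA cfree_winv ?fx.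
rewrite /sigma /cfree all_cat -!/(cfree _); apply/andP; split; last first.
  by case: d.2 => j /=; rewrite ?cfree_winv // fx.
rewrite /tau_word; elim: (rev _) => // -[i e] s IHs.
rewrite [ev _]/= /cfree all_cat -!/(cfree _) IHs andbT.
by case: e; [exact/cfree_winv/ftau | exact: ftau].
Qed.

Section Quotients.
Variable f : D -> free_group D.

Lemma act_cfree w d y : cfree w -> act (fstep f) w (d, y) = (act dstep w d, y).
Proof.
elim: w d => //= p w IHw d /andP[pc wc].
by rewrite /fstep /= (negPf pc) IHw.
Qed.

(** Containing no [c], the word [sigma d] and its inverse only carry [origin] to [d] and back; in
    between, [c] multiplies by [f d]. *)
Lemma act_conj_c_origin d y : act (fstep f) (conj_c d) (origin k, y) = (origin k, (y * f d)%g).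
Proof.
have actC u z : act (fstep f) C (u, z) = (u, (z * f u)%g).
  by rewrite /= /fstep /dstep /= ne_ca ne_cb eqxx.
rewrite /conj_c act_cat act_cat (act_cfree _ _ (cfree_sigma d)) actC act_sigma.
rewrite act_cfree ?cfree_winv ?cfree_sigma //.
by have := act_winvK dstepK (sigma d) (origin k); rewrite act_sigma => ->.
Qed.

Lemma act_conj_c_letters (s : seq (D * bool)) y : (forall p, p \in s -> f p.1 = gen p.1) ->
  act (fstep f) (ev [seq (conj_c p.1, p.2) | p <- s]) (origin k, y) =
  (origin k, (y * \prod_(p <- s) lgen p)%g).
Proof.
elim: s y => [|[d e] s IHs] y fs; first by rewrite big_nil mulg1.
rewrite [ev _]/= act_cat big_cons mulgA -IHs; last by move=> p ps; rewrite fs // inE ps orbT.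
have fd : f d = gen d by rewrite (fs (d, e)) // mem_head.
congr (act _ _ _); case: e {fs} => /=; last by rewrite act_conj_c_origin fd.
have := act_winvK (fstepK f) (conj_c d) (origin k, (y * (gen d)^-1)%g).
by rewrite act_conj_c_origin fd mulgVK.
Qed.
End Quotients.

(** * Freeness of the three quotients *)

Local Notation fquot := (free_quotient (@cat (V * bool)) (@winv V) [::]).

Lemma sigma_origin : sigma (origin k) = [::]. Proof. by []. Qed.

Lemma height_free : fquot (fun=> True) (fun w => height w = 0%R).
Proof.
have hB : height B = 1%R by rewrite /height big_seq1 /letter_height eqxx.
have hev e j : height (ev (nseq j (B, e))) = (if e then - j%:Z else j%:Z)%R.
  elim: j => [|j IHj]; first by rewrite [height _]big_nil; case: e.
  by rewrite [ev _]/= height_cat IHj {IHj}; case: e; rewrite ?height_winv hB; lia.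
exists (eq B); split=> // [w _ | s sB s0 rs].
  pose h := height w; exists (nseq `|h|%N (B, (h < 0)%R)); split.
    by move=> p; elim: `|h|%N => //= j IHj [<-|/IHj].
  by rewrite height_cat hev height_winv -/h; case: ifP; lia.
(* A reduced word in one generator has constant sign. *)
have [e [j ->]] : exists e j, s = nseq j.+1 (B, e).
  elim: s sB s0 rs => // -[w e] [|q s] IHs sB _ rs;
    have /= wB := sB _ (or_introl (erefl _)); subst w; first by exists e, 0.
  case: rs => ne /IHs [p ps|//|e' [j sE]]; first by apply: sB; right.
  exists e, j.+1; case: sE ne => -> -> /= ne; have -> // : e' = e.
  have h0 : height (winv B ++ B) = 0%R by rewrite height_cat height_winv addNr.
  by clear sB; case: e e' ne => [] [] // [].
by rewrite hev; case: e; lia.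
Qed.

Lemma dihedral_free : fquot (fun w => height w = 0%R) trivial_on_dihedral.
Proof.
exists (fun w => exists i, w = tau i); split.
- by move=> _ [i ->]; have := act_height (tau i) (1%g, 0%R); rewrite act_tau /= add0r.
- move=> w w0; have := act_height w (origin k); rewrite w0.
  case dE : (act dstep w (origin k)) => [v h] /= hE; rewrite hE addr0 in dE.
  (* The origin goes to [(v, 0)], and [w] agrees with [sigma (v, 0)] modulo the kernel; [rev]
     restores the order of the letters of [v]. *)
  exists [seq (tau p.1, p.2) | p <- rev (fg_word v)]; split.
    by move=> p; elim: (rev _) => //= q s IHs [<-|/IHs//]; exists q.1.
  have [u Hu wE] := decomposition w trivial_subgroup conj_c_trivial.
  have -> : ev [seq (tau p.1, p.2) | p <- rev (fg_word v)] = sigma (v, 0%R).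
    by rewrite /sigma cats0.
  have [Heq _ _ HV] := trivial_subgroup.
  apply: (Heq ((winv (sigma (v, 0%R)) ++ winv u) ++ sigma (v, 0%R))).
    by rewrite wE dE winv_cat.
  exact/trivial_normal/HV.
- move=> s sS s0 rs H.
  have [|s' sE _] := @lift_letters _ _ predT tau s.
    by move=> p /sS [i ->]; exists i.
  move: s0 rs H; rewrite sE => s0 rs /(_ (1%g, 0%R)); rewrite act_tau_letters mul1g => -[].
  apply: prod_lgen_neq1; last by case: (s') s0.
  apply: reduced_letters rs => i d.
  by rewrite (dstep_eq (mulVw edge m (tau i))).
Qed.

Hypothesis kf : kernel_free k l n.

Lemma kernel_quotient_free : fquot trivial_on_dihedral (fun w => w =w [::]).
Proof.
have [free [[f [fg fa fb]] gen_free]] := kf.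
exists (fun w => exists2 d, free d & w = conj_c d); split.
- by move=> _ [d _ ->]; exact: conj_c_trivial.
(* [H] is generated by the free conjugates. By [gen_free] it contains all [conj_c d], hence the
   whole kernel by [decomposition]. *)
- pose H w := exists2 s : seq (word V * bool),
    (forall p, List.In p s -> exists2 d, free d & p.1 = conj_c d) & w =w ev s.
  have sH : subgroup H.
    split=> [u v uv [s sS us] | | u v [s sS us] [t tS vt] | u [s sS us]].
    - by exists s => //; rewrite -uv.
    - by exists [::].
    - exists (s ++ t); last by rewrite eval_cat us vt.
      by move=> p pst; case: (List.in_app_or s t p pst); [exact: sS | exact: tS].
    - exists (rev [seq (p.1, ~~ p.2) | p <- s]).
        elim: s sS {us} => // q s IHs sS p; rewrite rev_cons -cats1 => ps.
        case: (List.in_app_or _ [:: _] p ps) => [|[<-|//]]; last by apply: (sS q); left.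
        by apply: IHs => t ts; apply: sS; right.
      rewrite us {us sS}; elim: s => // -[w e] s IHs.
      rewrite [ev _]/= winv_cat rev_cons -cats1 eval_cat IHs eval_letter /=.
      by case: e; rewrite ?winvK.
  have [Heq H1 HM HV] := sH.
  have HF d : free d -> H (conj_c d).
    move=> fd; exists [:: (conj_c d, false)]; last by rewrite /= cats0.
    by move=> p /= [<-|//]; exists d.
  have Hprod s : (forall y, y \in s -> H (conj_c y)) -> H (flatten (map conj_c s)).
    elim: s => //= y s IHs Hs; apply: HM; first by apply: Hs; rewrite mem_head.
    by apply: IHs => z zs; apply: Hs; rewrite inE zs orbT.
  have Hline u v w : H w -> u ++ w =w w ++ v -> (H u <-> H v).
    move=> Hw e; split=> Hx.
      apply: (Heq (winv w ++ u ++ w)); first by rewrite e mulKw.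
      exact: HM (HV _ Hw) (HM _ _ Hx Hw).
    apply: (Heq ((w ++ v) ++ winv w)); first by rewrite -e -catA mulwV cats0.
    exact: HM (HM _ _ Hw Hx) (HV _ Hw).
  have Hall d : H (conj_c d).
    apply: (gen_free (fun d => H (conj_c d)) HF _ _ d) => {}d Hd; apply: (Hline _ _ _ (Hprod _ Hd)).
      exact: conj_c_line sigma_stepa (rel_words edge_ac m_ac) l_gt0 d.
    exact: conj_c_line sigma_stepb (rel_words edge_bc m_bc) n_gt0 d.
  move=> w w1; have [u [s sS us] wE] := decomposition w sH Hall.
  exists s; split=> //; rewrite -us wE w1 sigma_origin cats0.
  by rewrite mulVw.
- move=> s sS s0 rs H.
  have [s' sE /allP fs] := @lift_letters _ _ free conj_c s sS.
  move: s0 rs H; rewrite sE => s0 rs.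
  (* At the origin each free [conj_c d] multiplies the second coordinate by [gen d], so this
     coordinate detects reduced words. *)
  move=> /(act_fstep_eq fa fb)/(_ (origin k, 1%g)); rewrite act_conj_c_letters; last first.
    by move=> p /fs/fg.
  rewrite mul1g => -[]; apply: prod_lgen_neq1; last by case: (s') s0.
  by apply: reduced_letters rs => d; exact: mulVw.
Qed.

Theorem triangle_poly_free : artin_poly_free edge m.
Proof.
exists 3, (fun i => match i with
  | 0 => fun w => w =w [::] | 1 => trivial_on_dihedral
  | 2 => fun w => height w = 0%R | _ => fun=> True end).
split=> // [[|[|[|i]]] | [|[|[|i]]] // _].
- split=> // [u v uv u1 | u v -> -> // | u ->] //.
  by rewrite -uv.
- exact: trivial_subgroup.
- split=> [u v /height_eq<- // | | u v | u]; first exact: big_nil.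
    by rewrite height_cat => -> ->.
  by rewrite height_winv => ->.
- by [].
- split; last exact: kernel_quotient_free.
  split=> [w /dstep_eq // | u w _ ->]; by rewrite cats0 mulVw.
- split; last exact: dihedral_free.
  split=> [w Hw | u w _]; last exact: trivial_normal.
  by have := act_height w (origin k); rewrite Hw add0r.
- split; last exact: height_free.
  by split=> // u w _; rewrite !height_cat height_winv => ->; lia.
Qed.
End Triangle.

Lemma even_triangle_poly_free (m01 m02 m12 : nat) (a b c : 'I_3) (k l n : nat) :
  let m := tri_label m01 m02 m12 in uniq [:: a; b; c] ->
  m a b = k.+1.*2 -> m a c = l.+1.*2 -> m b c = n.+1.*2 ->
  0 < k /\ 0 < n \/ l = 0 /\ n = 0 -> artin_poly_free tri_edge m.
Proof.
move=> m abc_uniq m_ab m_ac m_bc cases.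
have kf : kernel_free k l.+1 n.+1.
  case: cases => [[k0 n0]|[-> ->]]; last exact: flat_kernel_free.
  exact: hyperbolic_kernel_free.
have abcP v : v \in [:: a; b; c].
  have card3 : #|[:: a; b; c]| = #|'I_3| by rewrite (card_uniqP abc_uniq) card_ord.
  by rewrite (subset_cardP card3 (subset_predT _)).
have [ab ac bc] : [/\ a != b, a != c & b != c].
  by move: abc_uniq; rewrite /= !inE negb_or -andbA andbT => /and3P[].
by apply: (triangle_poly_free abcP abc_uniq _ ab ac bc _ m_ab m_ac m_bc _ _ kf)
  => // u v; rewrite /m /tri_label addnC.
Qed.

Theorem theoremB (m01 m02 m12 : nat) :
  2 <= m01 -> 2 <= m02 -> 2 <= m12 ->
  ~~ odd m01 -> ~~ odd m02 -> ~~ odd m12 ->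
  artin_poly_free tri_edge (tri_label m01 m02 m12).
Proof.
move=> g01 g02 g12 e01 e02 e12.
have half m : 2 <= m -> ~~ odd m -> exists k, m = k.+1.*2.
  by move=> m2 em; exists (m./2.-1); have := odd_double_half m; rewrite (negPf em); lia.
have [p01 E01] := half _ g01 e01; have [p02 E02] := half _ g02 e02.
have [p12 E12] := half _ g12 e12.
pose o0 := @Ordinal 3 0 isT; pose o1 := @Ordinal 3 1 isT; pose o2 := @Ordinal 3 2 isT.
(* A value [0] means a label 2. If two labels exceed 2, [b] is a vertex shared by two such edges;
   otherwise the edges [ac] and [bc] are chosen with label 2. *)
case: (posnP p01) => c01; case: (posnP p02) => c02; case: (posnP p12) => c12.
- by apply: (@even_triangle_poly_free _ _ _ o0 o1 o2 p01 p02 p12); auto.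
- by apply: (@even_triangle_poly_free _ _ _ o1 o2 o0 p12 p01 p02); auto.
- by apply: (@even_triangle_poly_free _ _ _ o0 o2 o1 p02 p01 p12); auto.
- by apply: (@even_triangle_poly_free _ _ _ o0 o2 o1 p02 p01 p12); auto.
- by apply: (@even_triangle_poly_free _ _ _ o0 o1 o2 p01 p02 p12); auto.
- by apply: (@even_triangle_poly_free _ _ _ o0 o1 o2 p01 p02 p12); auto.
- by apply: (@even_triangle_poly_free _ _ _ o1 o0 o2 p01 p12 p02); auto.
- by apply: (@even_triangle_poly_free _ _ _ o0 o1 o2 p01 p02 p12); auto.
Qed.
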